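(* Let $d\in\mathbb{N}$, $d\ge 1$. The Hausdorff dimension of the set $W(d)\subset\mathbb{R}^d$ is $d-1$.
   Context: For $x\in\mathbb{R}$, $\langle x\rangle=\min\{|x-k|:k\in\mathbb{Z}\}$ is the distance to the nearest integer, and on $\mathbb{R}^d$, $\|\mathbf{q}\|=\max_{1\le i\le d}|q_i|$. Let $\mathbb{Z}^d_{\ge0}=\{(q_1,\dots,q_d)\in\mathbb{Z}^d:q_1,\dots,q_d\ge0\}$. The set $W(d)$ consists of all $\mathbf{x}=(x_1,\dots,x_d)\in[-1,1]^d$ such that $\{1,x_1,\dots,x_d\}$ is linearly independent over $\mathbb{Z}$ and $$\limsup_{\|\mathbf{q}\|\to\infty,\ \mathbf{q}\in\mathbb{Z}^d_{\ge0}}\frac{-\log\langle\mathbf{q}\cdot\mathbf{x}\rangle}{\|\mathbf{q}\|^{d+1}\log\|\mathbf{q}\|}=\infty.$$ *)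

(* Defs.v *)
From HB Require Import structures.
From mathcomp Require Import all_boot all_order all_algebra.
From mathcomp Require Import all_classical all_reals all_analysis.

Set Implicit Arguments.
Unset Strict Implicit.
Unset Printing Implicit Defensive.

Import Order.TTheory GRing.Theory Num.Theory.
Import numFieldNormedType.Exports.

Local Open Scope classical_set_scope.
Local Open Scope ring_scope.

Section Hausdorff.
Context {R : realType} {V : normedModType R}.
Implicit Types (A U : set V) (s delta : R).
Local Open Scope ereal_scope.

(* The value is -oo on the empty set, which is therefore treated apart in
   [diam_pow]. *)
Definition diam U : \bar R :=
  ereal_sup [set `|z.1 - z.2|%R%:E | z in U `*` U].

(* diam(U)^s, with value 0 on the empty set; as [0 `^ 0 = 1], the gauge for
   s = 0 is 1 on every nonempty set, so that H^0 is the counting measure. *)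
Definition diam_pow s U : \bar R :=
  if U == set0 then 0 else diam U `^ s.

Definition hausdorff_premeasure s delta A : \bar R :=
  ereal_inf [set \sum_(0 <= i <oo) diam_pow s (U i)
            | U in [set U : (set V)^nat |
                A `<=` \bigcup_i U i /\ forall i, diam (U i) <= delta%:E]].

(* The premeasure is nonincreasing in delta: the supremum is the limit as delta
   tends to 0 from above. *)
Definition hausdorff_measure s A : \bar R :=
  ereal_sup [set hausdorff_premeasure s delta A
            | delta in [set delta | (0 < delta)%R]].

Definition hausdorff_dim A : \bar R :=
  ereal_inf [set s%:E
            | s in [set s | (0 <= s)%R /\ hausdorff_measure s A = 0]].

End Hausdorff.

Definition lin_indep_int {R : realType} {n : nat} (v : 'rV[R]_n) : Prop :=
  forall a : 'rV[int]_n, \sum_j (a 0 j)%:~R * v 0 j = 0 -> a = 0.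

(* The infimum is attained. *)
Definition dist_int {R : realType} (x : R) : R :=
  inf [set `|x - k%:~R| | k in [set: int]].

(* Vectors of Z^d_{>=0} are row vectors over [nat]. *)
Definition dot_nat {R : realType} {d : nat} (q : 'rV[nat]_d) (x : 'rV[R]_d) : R :=
  \sum_j (q 0 j)%:R * x 0 j.

Definition norm_nat {d : nat} (q : 'rV[nat]_d) : nat :=
  (\max_j q ord0 j)%N.

(* The filter "||q|| tends to infinity" on Z^d_{>=0}. *)
Definition norm_infty (d : nat) : set_system 'rV[nat]_d :=
  filter_from setT
    (fun N : nat => [set q : 'rV[nat]_d | (N <= norm_nat q)%N]).

(* The totalised values [ln 0 = 0] and [_ / 0 = 0] play no role in [W]: for x in
   [W R d] and q != 0, linear independence gives [dist_int (dot_nat q x) != 0],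
   and [ln (norm_nat q)%:R] is nonzero as soon as [1 < norm_nat q]. *)
Definition approx_quotient {R : realType} {d : nat} (x : 'rV[R]_d)
    (q : 'rV[nat]_d) : R :=
  - ln (dist_int (dot_nat q x))
    / ((norm_nat q)%:R ^+ d.+1 * ln (norm_nat q)%:R).

Definition W (R : realType) (d : nat) : set 'rV[R]_d :=
  [set x : 'rV[R]_d |
    [/\ forall j, -1 <= x 0 j <= 1,
        lin_indep_int (row_mx (const_mx 1 : 'rV[R]_1) x) &
        limf_esup (fun q => (approx_quotient x q)%:E) (@norm_infty d)
          = +oo%E]].
Arguments W : clear implicits.

(* Main.v *)
Require Import Defs.
From mathcomp Require Import finmap.
From mathcomp Require Import all_boot all_order all_algebra.
From mathcomp Require Import all_classical all_reals all_analysis.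
From mathcomp Require Import ring lra zify.

(** The upper bound is a Borel-Cantelli argument.  A point x of [W] satisfies,
for arbitrarily large n, an inequality |q . x - k| < n ^ -(n ^ (d + 1)) with
norm_nat q = n and k = O(n) ([dist_int_lt_approx_quotient]).  The part in the
unit cube of a slab of thickness 1/N around a hyperplane is covered by
N ^ (d - 1) cubes of side O(1/N) ([coverable_slab]), and N can be taken to be
2 ^ (p n) with p as large as desired.  At an exponent t > d - 1 each slab thus
costs O(2 ^ (- p n (t - (d - 1)))), which for p large beats the number of pairs
(q, k), a polynomial in n; the tails of the total cost tend to 0
([coverable_W]).

For the lower bound it is enough that one coordinate be extremely well
approximable.  Fix an irrational xi with distances from n xi to the integers
at most n ^ -(n ^ (d + 2)) for infinitely many n ([exists_Liouville]).  With
q = (n, 0, ..., 0), every point (xi, y) of the unit cube satisfies the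
approximation condition, whatever y is, and it belongs to [W] unless 1, xi and
the coordinates of y are linearly dependent over the integers.  Since xi is
irrational, dependence confines y to countably many hyperplanes, which are null
at the exponent d - 1 ([coverable_hyperplane]).  If [W] were null at some
exponent s < d - 1, then also at the exponent d - 1, and hence so would be its
projection to the last d - 1 coordinates; the whole cube of dimension d - 1
would be null, against [cube_not_coverable]: by compactness and a count of grid
points, cubes that cover the unit cube have total volume bounded below. *)

Import Order.TTheory GRing.Theory Num.Theory.
Import numFieldNormedType.Exports.

Set Implicit Arguments.
Unset Strict Implicit.
Unset Printing Implicit Defensive.

Local Open Scope classical_set_scope.
Local Open Scope ring_scope.

(** * Countable coverings *)

(** An actual covering of cost at most e, in place of the infimum over all
coverings: bounds of this form add up over countable unions without any
epsilon of room. *)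
Definition coverable (R : realType) (V : normedModType R) (s delta : R)
    (A : set V) (e : \bar R) : Prop :=
  exists U : (set V)^nat, [/\ A `<=` \bigcup_i U i,
    forall i, (diam (U i) <= delta%:E)%E &
    (\sum_(0 <= i <oo) diam_pow s (U i) <= e)%E].

Section Coverings.
Context {R : realType} {V : normedModType R}.
Implicit Types (A B U : set V) (s t delta r : R).
Local Open Scope ereal_scope.

Lemma diam_set0 : diam (set0 : set V) = -oo.
Proof.
rewrite /diam (_ : [set _ | _ in _] = set0) ?ereal_sup0//.
by apply/seteqP; split=> // x [[y z] [/=]].
Qed.

Lemma diam_le U r :
  (forall x y, U x -> U y -> (`|x - y| <= r)%R) -> diam U <= r%:E.
Proof.
by move=> Ur; apply: ge_ereal_sup => _ [[x y] [/= Ux Uy] <-]; rewrite lee_fin Ur.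
Qed.

Lemma norm_le_diam U x y : U x -> U y -> `|x - y|%:E <= diam U.
Proof. by move=> Ux Uy; apply: ereal_sup_ubound; exists (x, y). Qed.

Lemma diam_ge0 U : U !=set0 -> 0 <= diam U.
Proof. by move=> [x Ux]; have := norm_le_diam Ux Ux; rewrite subrr normr0. Qed.

Lemma diam_pow_ge0 s U : 0 <= diam_pow s U.
Proof. by rewrite /diam_pow; case: ifP => // _; exact: poweR_ge0. Qed.

Lemma diam_pow_set0 s : diam_pow s (set0 : set V) = 0.
Proof. by rewrite /diam_pow eqxx. Qed.

Lemma diam_pow_le s U r : (0 <= s)%R -> (0 <= r)%R -> diam U <= r%:E ->
  diam_pow s U <= (r `^ s)%:E.
Proof.
move=> s0 r0 Ur; rewrite /diam_pow; case: ifPn => [_|/set0P U0].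
  by rewrite lee_fin powR_ge0.
rewrite -poweR_EFin gt0_ler_poweR// ?in_itv/= ?leey ?andbT//.
exact: diam_ge0.
Qed.

Lemma diam_pow_antitone s t U : (0 <= s <= t)%R -> diam U <= 1 ->
  diam_pow t U <= diam_pow s U.
Proof.
move=> /andP[s0 st] U1; rewrite /diam_pow; case: ifPn => // /set0P U0.
have := diam_ge0 U0; move: U1; case: (diam U) => // r.
rewrite !poweR_EFin !lee_fin => r1; rewrite le_eqVlt => /predU1P[<-|r0]; last first.
  by rewrite ger_powR// r0.
have [t0|t0] := eqVneq t 0%R.
  by rewrite (_ : s = t)//; apply/le_anti; rewrite st t0 s0.
by rewrite powR0// powR_ge0.
Qed.

(** Coverings come indexed by grids, by integer vectors or by pairs; encoding
the index as a natural number and padding with the empty set, which costs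
nothing, gives a sequence of the same cost. *)
Lemma coverable_family s delta (I : countType) A (U : I -> set V) :
  A `<=` \bigcup_i U i -> (forall i, diam (U i) <= delta%:E) ->
  coverable s delta A (\esum_(i in [set: I]) diam_pow s (U i)).
Proof.
move=> AU Ud.
pose W n := if @pickle_inv I n is Some i then U i else set0.
have WU i : W (pickle i) = U i by rewrite /W pickleK_inv.
exists W; split.
- by move=> x /AU[i _ Uix]; exists (pickle i) => //; rewrite WU.
- by move=> n; rewrite /W; case: pickle_inv => // ; rewrite diam_set0 leNye.
rewrite nneseries_esumT; last by move=> n; exact: diam_pow_ge0.
rewrite [leRHS](_ : _ = \esum_(i in [set: I]) diam_pow s (W (pickle i))); last first.
  by apply: eq_esum => i _; rewrite WU.
rewrite -(esum_image _ pickle (fun n => diam_pow s (W n))); last first.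
  by move=> i j _ _; exact: (pcan_inj pickleK).
rewrite esum_mkcond [leRHS]esum_mkcond; apply: le_esum => n _.
rewrite in_setT; case: ifPn => // /negP nW.
rewrite /W; case E : pickle_inv => [i|]; last by rewrite diam_pow_set0.
exfalso; apply: nW; rewrite inE; exists i => //.
by have := @pickle_invK I n; rewrite /ocancel/oapp E.
Qed.

Lemma coverable_le s delta A B e f : A `<=` B -> e <= f ->
  coverable s delta B e -> coverable s delta A f.
Proof.
move=> AB ef [U [BU Ud Ue]]; exists U; split => //; last exact: le_trans ef.
exact: subset_trans BU.
Qed.

(** Countable subadditivity: the coverings of the A i are concatenated, and the
double sum of nonnegative costs can be computed one i at a time. *)
Lemma coverable_bigcup s delta (I : countType) (A : I -> set V) e :
  (forall i, coverable s delta (A i) (e i)) ->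
  coverable s delta (\bigcup_i A i) (\esum_(i in [set: I]) e i).
Proof.
move=> /choice[U covU].
apply: (@coverable_le _ _ _ (\bigcup_i A i) _ _ _ _
  (@coverable_family s delta (I * nat)%type _ (fun k => U k.1 k.2) _ _)) => //.
- rewrite [leLHS](_ : _ = \esum_(i in [set: I]) \esum_(n in [set: nat])
      diam_pow s (U i n)); last first.
    rewrite esum_esum; last by move=> *; exact: diam_pow_ge0.
    by congr esum; apply/seteqP; split.
  apply: le_esum => i _; rewrite -nneseries_esumT; last by move=> n; exact: diam_pow_ge0.
  by have [] := covU i.
- move=> x [i _ Aix]; have [AU _ _] := covU i.
  by have [n _ Ux] := AU _ Aix; exists (i, n).
- by move=> [i n]; have [_ + _] := covU i; exact.
Qed.

Lemma esum_finType (I : finType) (a : I -> \bar R) : (forall i, 0 <= a i) ->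
  \esum_(i in [set: I]) a i = \sum_i a i.
Proof.
move=> a0; have <- : [set` enum I] = [set: I].
  by apply/seteqP; split=> // i _; rewrite /= mem_enum.
by rewrite esum_fset// -fsbig_seq ?enum_uniq// big_enum.
Qed.

(** A set of diameter at most 1 costs less at a larger exponent, so the same
covering works. *)
Lemma coverable_exponent s t A e : (0 <= s <= t)%R ->
  coverable s 1 A e -> coverable t 1 A e.
Proof.
move=> st [U [AU U1 Ue]]; exists U; split => //; apply: le_trans Ue.
apply: lee_nneseries => [n _ _|n _]; first exact: diam_pow_ge0.
exact: diam_pow_antitone.
Qed.

Lemma hausdorff_measure_eq0_coverable s A : hausdorff_measure s A = 0 ->
  forall delta e, (0 < delta)%R -> (0 < e)%R -> coverable s delta A e%:E.
Proof.
move=> H0 delta e d0 e0.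
have : hausdorff_premeasure s delta A < e%:E.
  apply: (@le_lt_trans _ _ 0); last by rewrite lte_fin.
  by rewrite -H0; apply: ereal_sup_ubound; exists delta.
by move=> /ereal_inf_lt[_ [U [AU Ud] <-] Ue]; exists U; split => //; exact: ltW.
Qed.

Lemma coverable_hausdorff_measure_eq0 s A :
  (forall delta e, (0 < delta)%R -> (0 < e)%R -> coverable s delta A e%:E) ->
  hausdorff_measure s A = 0.
Proof.
move=> cov; apply/eqP; rewrite eq_le; apply/andP; split.
  apply: ge_ereal_sup => _ [delta /= d0 <-]; apply/lee_addgt0Pr => e e0.
  rewrite add0e; have [U [AU Ud Ue]] := cov delta e d0 e0.
  by apply: le_trans Ue; apply: ereal_inf_lbound; exists U.
apply: (@le_trans _ _ (hausdorff_premeasure s 1 A)).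
  apply: le_ereal_inf_tmp => _ [U _ <-]; apply: nneseries_ge0 => n _ _.
  exact: diam_pow_ge0.
by apply: ereal_sup_ubound; exists 1%R => //=.
Qed.

End Coverings.

Lemma coverable_set0 (R : realType) (V : normedModType R) (s delta : R) :
  coverable s delta (set0 : set V) 0%E.
Proof.
exists (fun=> set0); split => // [_|]; first by rewrite diam_set0 leNye.
by rewrite eseries0// => n _ _; rewrite diam_pow_set0.
Qed.

(** The covering of A i is chosen of cost e / 2 ^ (n + 1), where n is the code
of i. *)
Lemma coverable_null_bigcup (R : realType) (V : normedModType R) (s delta : R)
    (I : countType) (A : I -> set V) :
    (forall i e, 0 < e -> coverable s delta (A i) e%:E) ->
  forall e, 0 < e -> coverable s delta (\bigcup_i A i) e%:E.
Proof.
move=> Anull e e0.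
pose B n := if @pickle_inv I n is Some i then A i else set0.
apply: (@coverable_le _ _ _ _ _ (\bigcup_n B n) _ _ _ _
  (@coverable_bigcup _ _ s delta nat B (fun n => (e / (2 ^ n.+1)%:R)%:E) _)).
- by move=> x [i _ Aix]; exists (pickle i) => //; rewrite /B pickleK_inv.
- rewrite -nneseries_esumT; last by move=> n; rewrite lee_fin divr_ge0// ltW.
  exact: (epsilon_trick0 xpredT (ltW e0)).
- move=> n; have en0 : 0 < e / (2 ^ n.+1)%:R by rewrite divr_gt0// ltr0n expn_gt0.
  rewrite /B; case: pickle_inv => [i|]; first exact: Anull.
  apply: (@coverable_le _ _ _ _ _ set0 0%E) => //; last exact: coverable_set0.
  by rewrite lee_fin ltW.
Qed.

(** The images of the sets of a covering have no larger diameter. *)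
Lemma coverable_image (R : realType) (V V' : normedModType R) (f : V -> V')
    (s delta : R) (A : set V) (e : \bar R) : 0 <= s ->
  (forall x y, `|f x - f y| <= `|x - y|) ->
  coverable s delta A e -> coverable s delta (f @` A) e.
Proof.
move=> s0 fL [U [AU Ud Ue]]; exists (fun i => f @` U i).
have fU i : (diam (f @` U i) <= diam (U i))%E.
  apply: ge_ereal_sup => _ [[_ _] [/= [x Ux <-] [y Uy <-]] <-].
  apply: (le_trans _ (norm_le_diam Ux Uy)).
  by rewrite lee_fin fL.
split => [_ [x /AU[i _ Ux] <-]|i|]; first by exists i => //; exists x.
  exact: le_trans (Ud i).
apply: le_trans Ue; apply: lee_nneseries => [n _ _|n _]; first exact: diam_pow_ge0.
rewrite {1}/diam_pow; case: ifPn => [_|fU0]; first exact: diam_pow_ge0.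
have U0 : U n !=set0 by move/set0P : fU0 => [_ [x Ux _]]; exists x.
rewrite /diam_pow ifF; last by apply/negbTE/set0P.
rewrite gt0_ler_poweR// in_itv/= leey andbT; apply: diam_ge0 => //.
exact/set0P.
Qed.

(** * Slabs around hyperplanes *)

Lemma row_norm_le (R : realType) n (x : 'rV[R]_n) (r : R) :
  0 <= r -> (forall j, `|x 0 j| <= r) -> `|x| <= r.
Proof.
move=> r0 xr; rewrite /Num.norm/= mx_normrE; apply: bigmax_le => // -[i j] _ /=.
by rewrite ord1.
Qed.

Lemma entry_le_row_norm (R : realType) n (x : 'rV[R]_n) j : `|x 0 j| <= `|x|.
Proof.
by rewrite [leRHS]/Num.norm/= mx_normrE; apply/bigmax_geP; right; exists (0, j).
Qed.

Lemma unit_interval_index (R : realType) N (z : R) : (0 < N)%N -> 0 <= z <= N%:R ->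
  exists k : 'I_N, k%:R <= z <= k.+1%:R.
Proof.
elim: N => // -[_ _ zN|N IH _ /andP[z0 zN]]; first by exists ord0.
have [zN'|zN'] := leP z N.+1%:R; last by exists ord_max; rewrite ltW.
have [|k kz] := IH isT; first by rewrite z0.
by exists (widen_ord (leqnSn _) k).
Qed.

(** A slab of thickness 1/N around a hyperplane has size O(1/N) in the direction
of the coordinate with the largest coefficient: fixing the other m coordinates
up to 1/N leaves only an interval of length O(1/N) for that one.  So N ^ m
cubes of size O(1/N) suffice in dimension m + 1. *)
Lemma coverable_slab (R : realType) m (a : 'rV[R]_m.+1) (c t delta : R) N :
    0 <= t -> (0 < N)%N -> (exists j, 1 <= `|a 0 j|) ->
    (2 * m.+1)%:R / N%:R <= delta ->
  coverable t delta
    [set x : 'rV[R]_m.+1 | (forall j, `|x 0 j| <= 1) /\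
       `|\sum_j a 0 j * x 0 j - c| <= N%:R^-1]
    (N%:R ^+ m * ((2 * m.+1)%:R / N%:R) `^ t)%:E.
Proof.
move=> t0 N0 [j1 aj1] ddelta; set S := [set x | _]; set r := (2 * m.+1)%:R / N%:R.
have r0 : 0 <= r by rewrite divr_ge0.
have N0R : 0 < N%:R :> R by rewrite ltr0n.
have [j0 _ amax] := @Order.TotalTheory.arg_maxP _ _ 'I_m.+1 j1 predT
  (fun j => `|a 0 j|) isT.
have aj0 : 1 <= `|a 0 j0| by apply: le_trans aj1 (amax _ _).
pose U (g : {ffun 'I_m -> 'I_N}) := S `&` [set x : 'rV[R]_m.+1 |
  forall j, `|x 0 (lift j0 j) + 1 - (2 * g j + 1)%:R / N%:R| <= N%:R^-1].
have dU g : (diam (U g) <= r%:E)%E.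
  apply: diam_le => x y [[_ xS] xg] [[_ yS] yg].
  have xy j : `|x 0 (lift j0 j) - y 0 (lift j0 j)| <= 2 / N%:R.
    have := xg j; have := yg j; rewrite !ler_distl => /andP[? ?] /andP[? ?].
    by apply/andP; split; lra.
  apply: row_norm_le => // j; rewrite !mxE.
  have [{}j ->|->] := unliftP j0 j.
    apply: le_trans (xy j) _; rewrite /r ler_pM2r ?invr_gt0//.
    by rewrite ler_nat; lia.
  (* The equation of the slab determines the coordinate j0 from the others. *)
  have sum_xy : a 0 j0 * (x 0 j0 - y 0 j0) =
      (\sum_j a 0 j * x 0 j - c) - (\sum_j a 0 j * y 0 j - c) -
      \sum_j a 0 (lift j0 j) * (x 0 (lift j0 j) - y 0 (lift j0 j)).
    under [X in _ = _ - X]eq_bigr do rewrite mulrBr.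
    by rewrite sumrB !(bigD1_ord j0)//=; ring.
  rewrite -(ler_pM2l (lt_le_trans ltr01 aj0)) -normrM sum_xy.
  apply: (@le_trans _ _ (N%:R^-1 + N%:R^-1 + \sum_(j < m) `|a 0 j0| * (2 / N%:R))).
    apply: le_trans (ler_normB _ _) _; apply: lerD.
      by apply: le_trans (ler_normB _ _) _; apply: lerD.
    apply: le_trans (ler_norm_sum _ _ _) _; apply: ler_sum => k _.
    by rewrite normrM ler_pM//; exact: amax.
  rewrite sumr_const card_ord -[X in _ + X <= _]mulr_natr /r.
  have -> : `|a 0 j0| * ((2 * m.+1)%:R / N%:R) =
      `|a 0 j0| * (2 / N%:R) + `|a 0 j0| * (2 / N%:R) * m%:R.
    by rewrite natrM -natr1; ring.
  rewrite lerD2r.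
  have N1 : 0 <= N%:R^-1 :> R by rewrite invr_ge0.
  by have := ler_wpM2l N1 aj0; lra.
apply: (@coverable_le _ _ _ _ _ S _ _ _ _ (@coverable_family _ _ t delta _ S U _ _)) => //.
- rewrite esum_finType; last by move=> g; exact: diam_pow_ge0.
  apply: (@le_trans _ _ (\sum_(g : {ffun 'I_m -> 'I_N}) (r `^ t)%:E)%E).
    by apply: lee_sum => g _; exact: diam_pow_le.
  by rewrite sumEFin lee_fin sumr_const card_ffun !card_ord -[leLHS]mulr_natl natrX.
- move=> x xS; have [x1 _] := xS.
  have /choice[g gP] : forall j, exists k : 'I_N,
      `|x 0 (lift j0 j) + 1 - (2 * k + 1)%:R / N%:R| <= N%:R^-1.
    move=> j; have := x1 (lift j0 j); rewrite ler_norml => /andP[xl xu].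
    have [|k /andP[kl ku]] := @unit_interval_index R N
        ((x 0 (lift j0 j) + 1) * N%:R / 2) N0.
      apply/andP; split; first by rewrite divr_ge0// mulr_ge0//; lra.
      by rewrite ler_pdivrMr// mulrC ler_wpM2l//; lra.
    exists k; rewrite -(ler_pM2r N0R) mulVf ?gt_eqF//.
    rewrite -{2}(gtr0_norm N0R) -normrM mulrBl divfK ?gt_eqF//.
    rewrite ler_norml natrD natrM; move: ku; rewrite -[k.+1%:R]natr1 => ku.
    by apply/andP; split; lra.
  by exists (finfun g) => //; split => // j; rewrite ffunE.
- by move=> g; apply: le_trans (dU g) _; rewrite lee_fin.
Qed.

(** * The cube has positive measure *)

(** An interval of length 2 r contains at most 2 r N + 1 points of (1/N)Z, and
the extra 1 is at most r N. *)
Lemma card_grid_interval (R : realType) N (c r : R) : (0 < N)%N -> 1 <= r * N%:R ->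
  #|[pred k : 'I_N | `|c - k%:R / N%:R| < r]|%:R <= 3 * r * N%:R.
Proof.
move=> N0 rN; set A := [pred k : 'I_N | _].
have N0R : 0 < N%:R :> R by rewrite ltr0n.
have [k0 Ak0|A0] := pickP A; last by rewrite (eq_card0 A0); lra.
have [k1 Ak1 kmin] := arg_minnP (fun k : 'I_N => nat_of_ord k) Ak0.
pose M := Num.trunc (2 * r * N%:R).
have rN0 : 0 <= 2 * r * N%:R by lra.
have /andP[M1 M2] := truncn_itv rN0.
have kM k : k \in A -> (k - k1 < M.+1)%N.
  move=> kA; have k1k := kmin _ kA; rewrite -(ltr_nat R) natrB//.
  apply: lt_trans M2; move: kA Ak1; rewrite !inE !ltr_distl => /andP[h1 h2] /andP[h3 h4].
  have : k%:R / N%:R - k1%:R / N%:R < 2 * r by lra.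
  by rewrite -mulrBl ltr_pdivrMr.
have inj : {in A &, injective (fun k : 'I_N => inord (k - k1) : 'I_M.+1)}.
  move=> k k' kA k'A /(congr1 (@nat_of_ord _)); rewrite /= !inordK ?kM// => e.
  by apply: val_inj; have := kmin _ kA; have := kmin _ k'A; move: e => /=; lia.
have : (#|A| <= M.+1)%N.
  by rewrite -(card_in_imset inj) -[M.+1 in leqRHS]card_ord max_card.
by rewrite -(ler_nat R) -natr1; move: M1; rewrite -/M; lra.
Qed.

(** Compactness reduces to finitely many cubes, and these must contain all the
points of a grid that is finer than each of them. *)
Lemma finite_volume_of_cover (R : realType) m (c : nat -> 'rV[R]_m) (r : nat -> R) :
    (forall i, 0 < r i) ->
    [set x : 'rV[R]_m | forall j, `|x 0 j| <= 1] `<=` \bigcup_i ball (c i) (r i) ->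
  exists D : {fset nat}, 1 <= \sum_(i <- D) (3 * r i) ^+ m.
Proof.
move=> r0 cov.
have : compact [set x : 'rV[R]_m | forall j, `|x 0 j| <= 1].
  rewrite (_ : mkset _ = [set x : 'rV[R]_m | forall j, `[-1, 1]%classic (x 0 j)]).
    by apply: (@rV_compact R m (fun=> `[-1, 1]%classic)) => _; exact: segment_compact.
  by apply/seteqP; split=> x /= xP j; have := xP j; rewrite in_itv/= ler_norml.
rewrite compact_cover => /(_ _ setT (fun i => ball (c i) (r i))).
move=> [i _|//|D _ covD]; first exact: ball_open.
exists D.
(* The mesh 1/N is at most every radius r i with i in D. *)
pose N := (\max_(i <- D) (Num.trunc (r i)^-1).+1).+1.
have rN i : i \in D -> 1 <= r i * N%:R.
  move=> iD; rewrite mulrC -ler_pdivrMr//; rewrite div1r.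
  have ri0 : 0 <= (r i)^-1 by rewrite invr_ge0 ltW.
  have /andP[_ /ltW/le_trans] := truncn_itv ri0; apply.
  by rewrite ler_nat leqW// (@leq_bigmax_seq _ _ xpredT (fun i => (Num.trunc (r i)^-1).+1)).
have N0R : 0 < N%:R :> R by rewrite ltr0n.
pose F i (j : 'I_m) := [pred k : 'I_N | `|c i 0 j - k%:R / N%:R| < r i].
have Fcov (g : {ffun 'I_m -> 'I_N}) : exists2 i, i \in D & g \in family (F i).
  have [j|i /= iD] := covD (\row_j ((g j)%:R / N%:R)).
    rewrite mxE ger0_norm ?divr_ge0// ler_pdivrMr// mul1r ler_nat.
    exact: ltnW.
  rewrite -ball_normE /ball_/= => gi; exists i => //; apply/familyP => j.
  rewrite inE; apply: le_lt_trans gi.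
  by have := entry_le_row_norm (c i - \row_j ((g j)%:R / N%:R)) j; rewrite !mxE.
(* All N ^ m points of the grid are counted at least once. *)
have : (N ^ m <= \sum_(i <- D) #|(family (F i) : simpl_pred {ffun 'I_m -> 'I_N})|)%N.
  rewrite -[N in leqLHS]card_ord -[m in leqLHS]card_ord -card_ffun.
  under eq_bigr do rewrite -sum1_card big_mkcond.
  rewrite exchange_big/= -sum1_card; apply: leq_sum => g _.
  have [i iD gi] := Fcov g.
  by rewrite (big_rem i)//= gi.
rewrite -(ler_nat R) natrX natr_sum => le_sum.
rewrite -(ler_pM2l (exprn_gt0 m N0R)) mulr1; apply: le_trans le_sum _.
rewrite mulr_sumr big_seq [leRHS]big_seq; apply: ler_sum => i iD.
rewrite card_family foldrE big_image/= natr_prod -exprMn.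
rewrite -[m in leRHS]card_ord -prodr_const; apply: ler_prod => j _.
rewrite ler0n/= mulrC; exact: card_grid_interval (rN _ iD).
Qed.

(** Lebesgue measure in disguise: a set of diameter d lies in a cube of side
comparable to d, so a covering of small cost would be a covering by cubes of
small total volume. *)
Lemma cube_not_coverable (R : realType) m (delta : R) : (0 < m)%N -> 
  ~ coverable m%:R delta [set x : 'rV[R]_m | forall j, `|x 0 j| <= 1]
      ((4 * 6 ^+ m)^-1)%:E.
Proof.
move=> m0 [U [cov Ud]]; set e := (_ ^-1) => Ue.
have C0 : 0 < 6 ^+ m :> R by exact: exprn_gt0.
have e0 : 0 < e by rewrite invr_gt0 mulr_gt0.
have e1 : e <= 1.
  rewrite /e invf_le1 ?mulr_gt0//.
  by have := exprn_ege1 m (_ : 1 <= 6 :> R); lra.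
(* A set of diameter d lies in every open ball of radius d + eta around one of
its points; the eta i make the balls open and nondegenerate, and their total
is at most e. *)
pose c i := xget 0 (U i).
pose eta i : R := e / (2 ^ i.+1)%:R.
have eta0 i : 0 < eta i by rewrite divr_gt0// ltr0n expn_gt0.
pose d i : R := if U i == set0 then 0 else fine (diam (U i)).
have dE i : U i !=set0 -> diam (U i) = (d i)%:E.
  move=> U0; rewrite /d ifF ?fineK//; last by apply/negbTE/set0P.
  by rewrite ge0_fin_numE ?diam_ge0// (le_lt_trans (Ud i))// ltry.
have d0 i : 0 <= d i.
  rewrite /d; case: ifPn => // /set0P U0; apply: fine_ge0; exact: diam_ge0.
have dm i : (((d i) ^+ m)%:E <= diam_pow m%:R (U i))%E.
  rewrite /diam_pow; case: ifPn => [U0|/set0P U0].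
    by rewrite /d U0 expr0n gtn_eqF.
  by rewrite dE// poweR_EFin powR_mulrn.
have [i|x /cov[i _ Ux]|D] := @finite_volume_of_cover R m c (fun i => d i + eta i).
- by rewrite ltr_wpDl.
- exists i => //; rewrite -ball_normE /ball_/=.
  rewrite ltr_pwDr// -lee_fin -dE; last by exists x.
  by apply: norm_le_diam => //; rewrite /c; apply: xgetPex; exists x.
apply/negP; rewrite -ltNge.
have pow2 i : (3 * (d i + eta i)) ^+ m <= 6 ^+ m * ((d i) ^+ m + eta i).
  have h : 3 * (d i + eta i) <= 6 * Num.max (d i) (eta i).
    have : d i <= Num.max (d i) (eta i) by rewrite le_max lexx.
    have : eta i <= Num.max (d i) (eta i) by rewrite le_max lexx orbT.
    by lra.
  apply: (@le_trans _ _ ((6 * Num.max (d i) (eta i)) ^+ m)).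
    by rewrite lerXn2r ?nnegrE ?mulr_ge0 ?addr_ge0 ?le_max ?d0// ltW.
  rewrite exprMn ler_pM2l//.
  have eta1 : eta i ^+ m <= eta i.
    rewrite -[leRHS]expr1 ler_wiXn2l//; first exact: ltW.
    rewrite /eta ler_pdivrMr ?ltr0n ?expn_gt0// mul1r (le_trans e1)//.
    by rewrite ler1n expn_gt0.
  have dm0 : 0 <= d i ^+ m by exact: exprn_ge0.
  by case: (leP (d i) (eta i)) => _; have := ltW (eta0 i); lra.
apply: le_lt_trans (ler_sum _ (fun i _ => pow2 i)) _.
rewrite -mulr_sumr.
suff : \sum_(i <- D) (d i ^+ m + eta i) <= e + e.
  move=> /(ler_wpM2l (ltW C0))/le_lt_trans; apply.
  have -> : 6 ^+ m * (e + e) = 2^-1.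
    by rewrite /e; field; rewrite gt_eqF.
  by lra.
rewrite -lee_fin EFinD.
apply: (@le_trans _ _ (\sum_(0 <= i <oo) diam_pow m%:R (U i) + e%:E)%E); last first.
  exact: leeD2r.
apply: (@le_trans _ _ (\sum_(0 <= i <oo) (diam_pow m%:R (U i) + (eta i)%:E))%E); last first.
  apply: epsilon_trick => [n|]; [exact: diam_pow_ge0|exact: ltW].
have /le_trans : ((\sum_(i <- D) (d i ^+ m + eta i))%:E <=
    \sum_(i <- D) (diam_pow m%:R (U i) + (eta i)%:E))%E.
  by rewrite -sumEFin; apply: lee_sum => i _; rewrite EFinD leeD2r.
apply; apply: lee_sum_fset_lim => n _.
by rewrite adde_ge0 ?diam_pow_ge0// lee_fin ltW.
Qed.

(** * A very well approximable irrational number *)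

Lemma dist_int_le (R : realType) (x : R) (k : int) : dist_int x <= `|x - k%:~R|.
Proof. by apply: ge_inf; [exists 0 => _ [i _ <-]|exists k]. Qed.

Lemma dist_int_lt (R : realType) (x e : R) : dist_int x < e ->
  exists k : int, `|x - k%:~R| < e.
Proof.
move=> xe; have hi : has_inf [set `|x - k%:~R| | k in [set: int]].
  by split; [exists `|x - 0%:~R|; exists 0|exists 0 => _ [i _ <-]].
have [|_ [k _ <-] ke] := inf_adherent (_ : 0 < e - dist_int x) hi.
  by rewrite subr_gt0.
by exists k; apply: lt_le_trans ke _; rewrite -/(dist_int x) addrC subrK.
Qed.

(** The nearest integers are the floor and its successor, and both are at a
positive distance. *)
Lemma dist_int_gt0 (R : realType) (x : R) : (forall k : int, x != k%:~R) ->
  0 < dist_int x.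
Proof.
move=> xZ; pose f := Num.floor x.
have /andP[fx xf] := floor_itv x.
have xf0 : 0 < x - f%:~R by rewrite subr_gt0 lt_neqAle eq_sym xZ.
have xf1 : 0 < (f + 1)%:~R - x by rewrite subr_gt0.
apply: (@lt_le_trans _ _ (Num.min (x - f%:~R) ((f + 1)%:~R - x))).
  by rewrite lt_min xf0.
apply: lb_le_inf; first by exists `|x - 0%:~R|; exists 0.
move=> _ [k _ <-]; rewrite ge_min; apply/orP.
have [kf|fk] := leP k f.
  left; rewrite (le_trans _ (ler_norm _))// lerD2l lerN2 ler_int//.
right; rewrite distrC (le_trans _ (ler_norm _))// lerD2r ler_int.
by rewrite lezD1.
Qed.

Section Liouville.
Context {R : realType} (psi : nat -> nat).

(* xi is the sum of the 2 ^- u k.  Cutting the series after its term of index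
k leaves a rational number with denominator n = 2 ^ u k, and the remainder is
at most 2 * 2 ^- u k.+1; the recursion for u makes n times this equal to
n ^- psi n. *)
Let u k : nat := iter k (fun v => v + 1 + v * psi (2 ^ v))%N 1%N.
Let s k : R := \sum_(i < k) 2 ^- u i.

Let u_gt k : (k < u k)%N.
Proof.
by elim: k => //= k IH; rewrite -/(u k) addn1 addSn ltnS (leq_trans IH)// leq_addr. Qed.

Let le_u i k : (i <= k)%N -> (u i <= u k)%N.
Proof.
elim: k => [|k IH]; first by rewrite leqn0 => /eqP ->.
rewrite leq_eqVlt => /predU1P[->//|/IH/leq_trans]; apply => /=.
by rewrite -/(u k) -addnA leq_addr.
Qed.

Let s_le i k : (i <= k)%N -> s i <= s k.
Proof.
move=> /subnK <-; elim: (k - i)%N => //= n; move/le_trans; apply.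
by rewrite addSn /s big_ord_recr/= lerDl invr_ge0 exprn_ge0.
Qed.

(* The remainder of the series is dominated by twice its first term. *)
Let s_bound i k : (i <= k)%N -> s k <= s i + 2 * 2 ^- u i.
Proof.
move=> /subnK <-; suff : s (k - i + i)%N + 2 * 2 ^- u (k - i + i)%N <= s i + 2 * 2 ^- u i.
  apply: le_trans; rewrite lerDl mulr_ge0// invr_ge0 exprn_ge0//.
elim: (k - i)%N => //= n; apply: le_trans.
rewrite addSn {1}/s big_ord_recr/= -/(s _) -addrA lerD2l.
set v := (n + i)%N; rewrite -/(u v).
have : 2 * 2 ^- (u v + 1 + u v * psi (2 ^ u v))%N <= 2 ^- u v :> R.
  rewrite addnAC addn1 exprS invfM mulrA divff// mul1r.
  by rewrite lef_pV2 ?posrE ?exprn_gt0// ler_eXn2l ?ltr1n// leq_addr.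
by lra.
Qed.

Lemma exists_well_approximable : exists2 xi : R, 0 <= xi <= 1 &
  forall N, exists n, (N <= n)%N /\
    exists p : int, 0 < n%:R * xi - p%:~R <= n%:R ^- psi n.
Proof.
have hs : has_sup (range s).
  split; first by exists (s 0); exists 0%N.
  by exists (s 0 + 2 * 2 ^- u 0) => _ [k _ <-]; exact: s_bound.
pose xi := sup (range s).
have s_xi k : s k <= xi by apply: ub_le_sup; [exact: hs.2|exists k].
have xi_s i : xi <= s i + 2 * 2 ^- u i.
  apply: ge_sup; first exact: hs.1.
  move=> _ [k _ <-]; have [ik|/ltnW ki] := leqP i k; first exact: s_bound.
  by rewrite (le_trans (s_le ki))// lerDl mulr_ge0// invr_ge0 exprn_ge0.
exists xi.
  have := s_xi 0%N; have := xi_s 0%N; rewrite /s !big_ord0 /u/= expr1.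
  by move=> h1 h2; apply/andP; split; lra.
move=> N; exists (2 ^ u N)%N; split.
  by rewrite ltnW// (leq_trans (u_gt N))// ltnW// ltn_expl.
exists (\sum_(i < N.+1) 2 ^ (u N - u i))%N%:Z.
have sN : (2 ^ u N)%:R * s N.+1 = ((\sum_(i < N.+1) 2 ^ (u N - u i))%N)%:R.
  rewrite /s mulr_sumr natr_sum; apply: eq_bigr => i _.
  by rewrite !natrX -exprB ?unitfE// le_u// -ltnS.
rewrite -pmulrn -sN -mulrBr; apply/andP; split.
  rewrite mulr_gt0 ?ltr0n ?expn_gt0// subr_gt0 (lt_le_trans _ (s_xi N.+2))//.
  by rewrite [X in _ < X]/s big_ord_recr/= ltrDl invr_gt0 exprn_gt0.
apply: (@le_trans _ _ ((2 ^ u N)%:R * (2 * 2 ^- u N.+1))).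
  by rewrite ler_wpM2l//; have := xi_s N.+1; lra.
rewrite /= -/(u N) natrX -exprM -addnA exprD addnC addn1 exprS invfM.
rewrite le_eqVlt; apply/orP; left; apply/eqP.
by field; rewrite !expf_neq0.
Qed.

End Liouville.

(** The approximations are positive, so they also force irrationality: if b xi
were an integer, b (n xi - p) would be a nonzero integer of absolute value
less than 1. *)
Lemma exists_Liouville (R : realType) (psi : nat -> nat) : (forall n, 0 < psi n)%N ->
  exists xi : R, [/\ 0 <= xi <= 1,
    forall a b : int, a%:~R + b%:~R * xi = 0 -> a = 0 /\ b = 0 &
    forall N, exists2 n, (N <= n)%N & dist_int (n%:R * xi) <= n%:R ^- psi n].
Proof.
move=> psi0; have [xi xi01 xiP] := @exists_well_approximable R psi.
exists xi; split => // [a b ab0|N]; last first.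
  have [n [Nn [p /andP[p0 pn]]]] := xiP N; exists n => //.
  by apply: le_trans (dist_int_le _ p) _; rewrite gtr0_norm.
have [b0|b0] := eqVneq b 0.
  by split => //; move/eqP: ab0; rewrite b0 mul0r addr0 intr_eq0 => /eqP.
have [n [bn [p /andP[p0 pn]]]] := xiP (`|b| + 2)%N.
have n0 : (0 < n)%N by lia.
have e : b%:~R * (n%:R * xi - p%:~R) = (- (n%:Z * a) - b * p)%:~R :> R.
  rewrite rmorphB rmorphN/= !intrM -pmulrn.
  by rewrite (_ : a%:~R = - (b%:~R * xi)); [ring|apply/eqP; rewrite -addr_eq0; apply/eqP].
have lt1 : `|b%:~R * (n%:R * xi - p%:~R)| < 1 :> R.
  rewrite normrM (gtr0_norm p0).
  apply: (@le_lt_trans _ _ (`|b|%:R * n%:R^-1)).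
    rewrite -intr_norm -natr_absz ler_wpM2l// (le_trans pn)//.
    rewrite lef_pV2 ?posrE ?exprn_gt0 ?ltr0n//.
    by rewrite -[leLHS]expr1 ler_weXn2l ?ler1n.
  by rewrite ltr_pdivrMr ?ltr0n// mul1r ltr_nat; lia.
move: lt1; rewrite e -intr_norm (_ : 1 = 1%:~R)// ltr_int => lt1.
have : (- (n%:Z * a) - b * p)%:~R = 0 :> R.
  by apply/eqP; rewrite intr_eq0 -normr_le0; lia.
rewrite -e => /eqP; rewrite mulf_eq0 intr_eq0 (negbTE b0) gt_eqF//.
Qed.

(** * The upper bound *)

Lemma limf_esup_norm_infty (R : realType) d (f : 'rV[nat]_d -> R) :
  limf_esup (fun q => (f q)%:E) (@norm_infty d) = +oo%E <->
  forall (M : nat) (K : R), exists2 q, (M <= norm_nat q)%N & K < f q.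
Proof.
rewrite limf_esupE; split => [foo M K|fP].
  have : (K%:E < ereal_sup [set (f q)%:E | q in [set q | (M <= norm_nat q)%N]])%E.
    apply: (@lt_le_trans _ _ +oo%E); first exact: ltry.
    rewrite -foo; apply: ereal_inf_lbound.
    by exists [set q | (M <= norm_nat q)%N] => //; exists M.
  by move=> /ereal_sup_gt[_ [q Mq <-]]; rewrite lte_fin; exists q.
apply/eqP; rewrite eq_le leey/=; apply: le_ereal_inf_tmp => _ [A [M _ MA] <-].
rewrite leye_eq; apply/eqP/eqyP => K _; have [q Mq Kq] := fP M K.
apply: (@le_trans _ _ (f q)%:E); first by rewrite lee_fin ltW.
by apply: ereal_sup_ubound; exists q => //; exact: MA.
Qed.

(** A quotient greater than 1 cannot come from ln 0 = 0, so the inequality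
between logarithms can be exponentiated. *)
Lemma dist_int_lt_approx_quotient (R : realType) d (x : 'rV[R]_d) q :
  (1 < norm_nat q)%N -> 1 < approx_quotient x q ->
  dist_int (dot_nat q x) < (norm_nat q)%:R ^- (norm_nat q ^ d.+1).
Proof.
set n := norm_nat q => n1; rewrite /approx_quotient -/n; set D := dist_int _.
have n0 : 0 < n%:R :> R by rewrite ltr0n ltnW.
have lnn0 : 0 < ln n%:R :> R by rewrite ln_gt0// ltr1n.
rewrite ltr_pdivlMr ?mulr_gt0 ?exprn_gt0// mul1r => lnD.
have lnD0 : 0 < - ln D by apply: lt_trans lnD; rewrite mulr_gt0 ?exprn_gt0.
have D0 : 0 < D by rewrite ltNge; apply/negP => /ln0 D0; move: lnD0; rewrite D0 oppr0 ltxx.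
rewrite -ltr_ln ?posrE ?invr_gt0 ?exprn_gt0//.
rewrite lnV ?posrE ?exprn_gt0// lnXn// -[ln _ *+ _]mulr_natl natrX.
by rewrite ltrNr.
Qed.

Lemma eventually_half_pow_le (R : realType) (e : R) : 0 < e ->
  exists M, forall n, (M <= n)%N -> 2 ^- n <= e.
Proof.
move=> e0; have e0' : 0 <= e^-1 by rewrite invr_ge0 ltW.
exists (Num.trunc e^-1).+1 => n Mn; rewrite -[leRHS]invrK lef_pV2 ?posrE ?invr_gt0 ?exprn_gt0//.
have /andP[_ /ltW/le_trans] := truncn_itv e0'; apply.
by rewrite -natrX ler_nat (leq_trans Mn)// ltnW// ltn_expl.
Qed.

Section UpperBound.
Context {R : realType} (m : nat).

(* For x in the unit cube and q of norm n, the integer nearest to q . x is at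
most [bound n] in absolute value. *)
Let bound n := (m.+1 * n + 1)%N.

(* The neighbourhoods, of width 2 ^ -(p n), of all the hyperplanes q . x = k
with q of norm at most n.  The vector q is i.1 and the integer k is
i.2 - bound n. *)
Let shell (p n : nat) : set 'rV[R]_m.+1 :=
  \bigcup_(i : {ffun 'I_m.+1 -> 'I_n.+1} * 'I_(2 * bound n + 1))
    [set x : 'rV[R]_m.+1 | (exists j, 0 < i.1 j)%N /\
      ((forall j, `|x 0 j| <= 1) /\
       `|\sum_j (\row_j (i.1 j)%:R) 0 j * x 0 j - (i.2%:R - (bound n)%:R)|
           <= (2 ^ (p * n))%:R^-1)].

Let W_sub_shell (p n : nat) x q : (1 < n)%N -> (p <= n)%N -> norm_nat q = n ->
  W R m.+1 x -> 1 < approx_quotient x q -> shell p n x.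
Proof.
move=> n1 pn qn [x1 _ _] /(@dist_int_lt_approx_quotient _ _ _ q).
rewrite qn => /(_ n1) /dist_int_lt[k kq].
have x1' j : `|x 0 j| <= 1 by rewrite ler_norml.
have qle j : (q 0%R j <= n)%N.
  by rewrite -qn /norm_nat; exact: (@leq_bigmax_cond _ predT (fun j => q ord0 j)).
have pow_le : n%:R ^- (n ^ m.+2) <= (2 ^ (p * n))%:R^-1 :> R.
  rewrite lef_pV2 ?posrE ?exprn_gt0 ?ltr0n ?expn_gt0// ?(ltnW n1)//.
  rewrite -natrX ler_nat; apply: (@leq_trans (2 ^ (n ^ m.+2))).
    rewrite leq_exp2l//; apply: (@leq_trans (n ^ 2)%N).
      by rewrite -mulnn leq_mul2r pn orbT.
    by rewrite leq_exp2l.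
  by rewrite leq_exp2r// expn_gt0 ltnW.
have dot_le : `|dot_nat q x| <= (m.+1 * n)%:R.
  apply: le_trans (ler_norm_sum _ _ _) _.
  apply: (@le_trans _ _ (\sum_(j < m.+1) n%:R)).
    apply: ler_sum => j _; rewrite normrM normr_nat.
    by rewrite -[leRHS]mulr1 ler_pM// ler_nat.
  by rewrite sumr_const card_ord natrM mulr_natl.
have kb : `|k| <= (bound n)%:Z.
  rewrite -(ler_int R) intr_norm -pmulrn /bound natrD.
  have pow1 : n%:R ^- (n ^ m.+2) <= 1 :> R.
    by rewrite invf_le1 ?exprn_gt0 ?exprn_ege1 ?ltr0n ?ler1n// ltnW.
  have -> : k%:~R = dot_nat q x - (dot_nat q x - k%:~R) :> R by ring.
  by rewrite (le_trans (ler_normB _ _))// lerD// ltW// (lt_le_trans kq).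
have kb' : (`|(k + (bound n)%:Z)%R|%N < 2 * bound n + 1)%N by lia.
exists ([ffun j => inord (q 0 j)], Ordinal kb') => //=; split.
  have [j qj] : exists j, q ord0 j = norm_nat q.
    have [|] := @bigop.eq_bigmax _ (fun j => q ord0 j); first by rewrite card_ord.
    by move=> j qj; exists j; rewrite /norm_nat qj.
  by exists j; rewrite ffunE inordK ?ltnS// qj qn ltnW.
split => //; apply: le_trans pow_le; apply: ltW; apply: le_lt_trans kq.
rewrite le_eqVlt; apply/orP; left; apply/eqP; congr `|_|; congr (_ - _).
  by apply: eq_bigr => j _; rewrite mxE ffunE inordK// ltnS.
rewrite natr_absz ger0_norm; last by lia.
by rewrite intrD -pmulrn addrK.
Qed.

(* One slab costs a constant times 2 ^ (- p n (t - m)), and there are at most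
(2 m + 5) 2 ^ (n (m + 2)) of them; the hypothesis on p makes the product
decay like 2 ^- n. *)
Let coverable_shell (t delta : R) (p n : nat) : 0 <= t ->
  (m.+3)%:R <= p%:R * (t - m%:R) ->
  (2 * m.+1)%:R / (2 ^ (p * n))%:R <= delta ->
  coverable t delta (shell p n) (((2 * m.+1)%:R `^ t * (2 * m + 5)%:R) / 2 ^+ n)%:E.
Proof.
move=> t0 pt dle.
pose N := (2 ^ (p * n))%N.
pose c : R := N%:R ^+ m * ((2 * m.+1)%:R / N%:R) `^ t.
have c0 : 0 <= c by rewrite mulr_ge0 ?exprn_ge0 ?powR_ge0.
apply: (coverable_le (fun x h => h) _ (@coverable_bigcup _ _ t delta _ _ (fun=> c%:E) _)).
  rewrite esum_finType// sumEFin lee_fin sumr_const card_prod card_ffun !card_ord.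
  rewrite -[leLHS]mulr_natl.
  have NE : N%:R = 2 `^ (p * n)%:R :> R by rewrite powR_mulrn// natrX.
  have cE : c = (2 * m.+1)%:R `^ t * 2 `^ (- (n%:R * (p%:R * (t - m%:R)))).
    rewrite /c powRM// -powR_mulrn// NE -powRN -!powRrM.
    by rewrite mulrCA -powRD ?pnatr_eq0 ?implybT//; congr (_ * _ `^ _); rewrite natrM; ring.
  have cle : c <= (2 * m.+1)%:R `^ t * 2 ^- (n * m.+3).
    rewrite cE ler_wpM2l ?powR_ge0// -powR_invn// ler_powR ?ler1n// lerN2 natrM.
    by rewrite ler_wpM2l.
  apply: le_trans (ler_wpM2l _ cle) _ => //.
  rewrite mulrCA -mulrA ler_wpM2l ?powR_ge0//.
  rewrite mulrC ler_pdivrMl ?exprn_gt0//.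
  have -> : 2 ^+ (n * m.+3) * ((2 * m + 5)%:R / 2 ^+ n) = (2 * m + 5)%:R * 2 ^+ (n * m.+2) :> R.
    by rewrite mulnS exprD; field; rewrite expf_neq0.
  rewrite -natrX -natrM ler_nat mulnS expnD mulnA mulnC leq_mul//; last first.
    by rewrite expnM leq_exp2r// ltn_expl.
  have := ltn_expl n (isT : 1 < 2)%N; rewrite /bound; nia.
move=> [g k] /=; have [gj|gj] := pselect (exists j, (0 < g j)%N); last first.
  by apply: (@coverable_le _ _ _ _ _ set0 0%E) => [x []||] //; exact: coverable_set0.
apply: (coverable_le _ _ (coverable_slab _ t0 _ _ dle)) => //.
- by move=> x [_ [x1 xk]]; split => //; exact: xk.
- by rewrite expn_gt0.
- by have [j j0] := gj; exists j; rewrite mxE normr_nat ler1n.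
Qed.

(** A point of W lies in shells of arbitrarily large index n, for any p fixed in
advance: the exponent n ^ (m + 2) of the approximation is at least p n.  The tail
of the series of the costs of the shells is therefore a bound. *)
Lemma coverable_W (t delta e : R) : m%:R < t -> 0 < delta -> 0 < e ->
  coverable t delta (W R m.+1) e%:E.
Proof.
move=> mt d0 e0.
have t0 : 0 < t by apply: le_lt_trans mt; rewrite ler0n.
pose C : R := (2 * m.+1)%:R `^ t * (2 * m + 5)%:R.
have C0 : 0 < C by rewrite mulr_gt0 ?powR_gt0 ?ltr0n ?muln_gt0 ?addn_gt0 ?orbT.
have tm : 0 < t - m%:R by rewrite subr_gt0.
have [|M1 M1P] := @eventually_half_pow_le R (e / (2 * C)).
  by rewrite divr_gt0// mulr_gt0.
have [|M2 M2P] := @eventually_half_pow_le R (delta / (2 * m.+1)%:R).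
  by rewrite divr_gt0// ltr0n muln_gt0.
pose p := (Num.trunc (m.+3%:R / (t - m%:R))).+1.
have pt : m.+3%:R <= p%:R * (t - m%:R).
  rewrite -ler_pdivrMr//.
  have h : 0 <= m.+3%:R / (t - m%:R) by rewrite divr_ge0// ltW.
  by have /andP[_ /ltW] := truncn_itv h.
pose M := (M1 + M2 + p + 2)%N.
apply: (coverable_le _ _ (@coverable_bigcup _ _ t delta nat
  (fun i => shell p (M + i)) (fun i => (C / 2 ^+ (M + i))%:E) _)).
- move=> x xW; have [_ _ /limf_esup_norm_infty xoo] := xW.
  have [q Mq q1] := xoo M 1; exists (norm_nat q - M)%N => //=; rewrite subnKC//.
  by apply: (W_sub_shell _ _ erefl xW q1); move: Mq; rewrite /M; lia.
- rewrite -nneseries_esumT; last first.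
    by move=> i; rewrite lee_fin divr_ge0 ?exprn_ge0// ltW.
  apply: le_trans (epsilon_trick0 xpredT (ltW e0)).
  apply: lee_nneseries => i _ *.
    by rewrite lee_fin divr_ge0 ?exprn_ge0// ltW.
  rewrite lee_fin exprD natrX exprS.
  have := M1P M; rewrite {1}/M -!addnA leq_addr => /(_ isT).
  rewrite ler_pdivlMr ?mulr_gt0// => h.
  have i0 : 0 < 2 ^+ i :> R by exact: exprn_gt0.
  rewrite !invfM !mulrA ler_pM2r ?invr_gt0//.
  by lra.
- move=> i; apply: coverable_shell => //; first exact: ltW.
  have /M2P : (M2 <= p * (M + i))%N by rewrite /M /p; nia.
  by rewrite ler_pdivlMr// mulrC natrX.
Qed.

End UpperBound.

(** * The lower bound *)

(** The slabs of thickness 1/N containing the hyperplane have volume O(1/N). *)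
Lemma coverable_hyperplane (R : realType) m (a : 'rV[R]_m.+1) (c e : R) :
    (exists j, 1 <= `|a 0 j|) -> 0 < e ->
  coverable m.+1%:R 1 [set x : 'rV[R]_m.+1 | (forall j, `|x 0 j| <= 1) /\
    \sum_j a 0 j * x 0 j = c] e%:E.
Proof.
move=> aj e0; pose C : R := (2 * m.+1)%:R ^+ m.+1.
have C0 : 0 <= C / e by rewrite divr_ge0 ?exprn_ge0// ltW.
pose N := (Num.trunc (C / e) + 2 * m.+1)%N.
have N0 : (0 < N)%N by rewrite /N; lia.
have N0R : 0 < N%:R :> R by rewrite ltr0n.
have dN : (2 * m.+1)%:R / N%:R <= 1 :> R.
  by rewrite ler_pdivrMr// mul1r ler_nat leq_addl.
apply: (coverable_le _ _ (coverable_slab c (ler0n R m.+1) N0 aj dN)).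
  by move=> x [x1 xc]; split => //; rewrite xc subrr normr0 invr_ge0.
rewrite lee_fin powR_mulrn// expr_div_n -/C exprS.
have -> : N%:R ^+ m * (C / (N%:R * N%:R ^+ m)) = C / N%:R.
  by field; rewrite expf_neq0 gt_eqF.
rewrite ler_pdivrMr// mulrC -ler_pdivrMr//.
have /andP[_ /ltW/le_trans] := truncn_itv C0; apply.
by rewrite ler_nat /N; lia.
Qed.

Section LowerBound.
Context {R : realType} (m : nat) (xi : R).
Context (xi01 : 0 <= xi <= 1).
Context (xi_irr : forall a b : int, a%:~R + b%:~R * xi = 0 -> a = 0 /\ b = 0).
Context (xi_approx : forall N, exists2 n, (N <= n)%N &
  dist_int (n%:R * xi) <= n%:R ^- (n ^ m.+3).+1).

Let lift_xi (y : 'rV[R]_m) : 'rV[R]_m.+1 :=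
  \row_j (if unlift ord0 j is Some i then y 0 i else xi).

Let lift_xi0 y : lift_xi y 0 ord0 = xi.
Proof. by rewrite mxE unlift_none. Qed.

Let lift_xiS y j : lift_xi y 0 (lift ord0 j) = y 0 j.
Proof. by rewrite mxE liftK. Qed.

(* The vectors q = (n, 0, ..., 0) see only the coordinate xi. *)
Let approx_quotient_lift_xi y (M : nat) (K : R) :
  exists2 q, (M <= norm_nat q)%N & K < approx_quotient (lift_xi y) q.
Proof.
have /andP[_] := truncn_itv (normr_ge0 K); set T := _.+1 => KT.
have [n nN dn] := xi_approx (M + T + 2)%N.
have n1 : (1 < n)%N by lia.
have n0 : 0 < n%:R :> R by rewrite ltr0n ltnW.
have Kn : K < n%:R.
  rewrite (le_lt_trans (ler_norm _))// (lt_le_trans KT)// ler_nat.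
  by lia.
pose q : 'rV[nat]_m.+1 := \row_j (if j == ord0 then n else 0%N).
have qn : norm_nat q = n.
  rewrite /norm_nat big_ord_recl mxE eqxx big1 ?maxn0// => j _.
  by rewrite mxE.
have qx : dot_nat q (lift_xi y) = n%:R * xi.
  rewrite /dot_nat big_ord_recl mxE eqxx lift_xi0 big1 ?addr0// => j _.
  by rewrite [q _ _]mxE mul0r.
exists q; first by rewrite qn; lia.
rewrite /approx_quotient qn qx; apply: (lt_le_trans Kn).
have lnn0 : 0 < ln n%:R :> R by rewrite ln_gt0// ltr1n.
have D0 : 0 < dist_int (n%:R * xi).
  apply: dist_int_gt0 => k; apply/eqP => nk.
  have [|_] := @xi_irr (- k) n%:Z; last by move=> [] n00; move: n1; rewrite n00.
  by rewrite rmorphN/= -nk -pmulrn addNr.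
rewrite ler_pdivlMr; last by apply: mulr_gt0 => //; exact: exprn_gt0.
rewrite mulrA -exprS lerNr.
apply: (@le_trans _ _ (ln (n%:R ^- (n ^ m.+3).+1))).
  by rewrite ler_ln ?posrE ?invr_gt0 ?exprn_gt0.
rewrite lnV ?posrE ?exprn_gt0// lnXn// lerN2 -[leRHS]mulr_natl.
by rewrite ler_pM2r// -natrX ler_nat.
Qed.

(* If the lift of y is not in W, then 1, xi and the coordinates of y are
linearly dependent; as 1 and xi are not, y lies on one of countably many
hyperplanes. *)
Let lift_xi_mem_W (y : 'rV[R]_m) : (forall j, `|y 0 j| <= 1) ->
  ~ (exists z : int * int * 'rV[int]_m, (exists j, z.2 0 j != 0) /\
     \sum_j (z.2 0 j)%:~R * y 0 j = - (z.1.1%:~R + z.1.2%:~R * xi)) ->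
  W R m.+1 (lift_xi y).
Proof.
move=> y1 ydep; split.
- move=> j; rewrite -ler_norml mxE; case: unlift => [i|]; first exact: y1.
  by have /andP[x0 x1] := xi01; rewrite ger0_norm.
- move=> a a0; pose b : 'rV[int]_m := \row_j a 0 (rshift 1 (lift ord0 j)).
  have e : (a 0 (lshift m.+1 ord0))%:~R + (a 0 (rshift 1 ord0))%:~R * xi +
      \sum_j (b 0 j)%:~R * y 0 j = 0 :> R.
    rewrite -[RHS]a0 big_split_ord big_ord1 big_ord_recl/= row_mxEl mxE mulr1.
    rewrite row_mxEr lift_xi0 -addrA; congr (_ + (_ + _)).
    by apply: eq_bigr => j _; rewrite row_mxEr lift_xiS mxE.
  have b0 j : b 0 j = 0.
    apply/eqP/negPn/negP => bj; apply: ydep.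
    exists (a 0 (lshift m.+1 ord0), a 0 (rshift 1 ord0), b); split; first by exists j.
    by apply/eqP; rewrite -addr_eq0 addrC e.
  move: e; rewrite big1 ?addr0; last by move=> j _; rewrite b0 mul0r.
  move=> /xi_irr[aa0 aa1]; apply/rowP => i; rewrite mxE.
  have [{}i ->|{}i ->] := split_ordP i; first by rewrite ord1.
  have [j ->|-> //] := unliftP ord0 i.
  by have := b0 j; rewrite mxE.
- by apply/limf_esup_norm_infty => M K; exact: approx_quotient_lift_xi.
Qed.

(** The projection of W to the last m coordinates contains the unit cube
deprived of countably many hyperplanes.  Both the projection of a null set and the hyperplanes are null,
while the cube is not. *)
Lemma not_null_W : (0 < m)%N ->
  ~ (forall e : R, 0 < e -> coverable m%:R 1 (W R m.+1) e%:E).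
Proof.
move=> m0 Wnull.
pose proj (x : 'rV[R]_m.+1) : 'rV[R]_m := \row_j x 0 (lift ord0 j).
pose A (i : option (int * int * 'rV[int]_m)) : set 'rV[R]_m :=
  if i is Some z then
    [set y : 'rV[R]_m | (exists j, z.2 0 j != 0) /\ (forall j, `|y 0 j| <= 1) /\
      \sum_j (z.2 0 j)%:~R * y 0 j = - (z.1.1%:~R + z.1.2%:~R * xi)]
  else proj @` W R m.+1.
apply: (@cube_not_coverable R m 1 m0).
apply: (@coverable_le _ _ _ _ _ (\bigcup_i A i) _ _ _ (lexx _)); last first.
  apply: coverable_null_bigcup; last by rewrite invr_gt0 mulr_gt0// exprn_gt0.
  move=> [z|] e e0 /=; last first.
    apply: coverable_image; [exact: ler0n| |exact: Wnull].
    move=> x y; apply: row_norm_le => // j.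
    by have := entry_le_row_norm (x - y) (lift ord0 j); rewrite !mxE.
  have [zj|zj] := pselect (exists j, z.2 0 j != 0); last first.
    apply: (@coverable_le _ _ _ _ _ set0 0%E); last exact: coverable_set0.
      by move=> y [].
    by rewrite lee_fin ltW.
  case: m m0 z zj => // k _ z [j zj].
  apply: (coverable_le _ (lexx _) (@coverable_hyperplane R k
    (\row_j (z.2 0 j)%:~R) (- (z.1.1%:~R + z.1.2%:~R * xi)) e _ e0)).
    move=> y [_ [y1 yz]]; split => //; rewrite -yz; apply: eq_bigr => i _.
    by rewrite mxE.
  exists j; rewrite mxE -intr_norm (_ : 1 = 1%:~R)// ler_int.
  by rewrite -gtz0_ge1 normr_gt0.
move=> y y1; have [[z [zj zy]]|ydep] := pselect (exists z : int * int * 'rV[int]_m,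
  (exists j, z.2 0 j != 0) /\
  \sum_j (z.2 0 j)%:~R * y 0 j = - (z.1.1%:~R + z.1.2%:~R * xi)).
  by exists (Some z).
exists None => //; exists (lift_xi y); first exact: lift_xi_mem_W.
by apply/rowP => j; rewrite mxE lift_xiS.
Qed.

End LowerBound.

(** * The dimension *)

Theorem theorem1p4 (R : realType) (d : nat) (hd : (1 <= d)%N) :
  hausdorff_dim (W R d) = (d%:R - 1)%:E.
Proof.
case: d hd => // m _; rewrite -natr1 addrK.
apply/eqP; rewrite eq_le; apply/andP; split.
  apply/lee_addgt0Pr => e e0; apply: ereal_inf_lbound; exists (m%:R + e) => //.
  have me : m%:R < m%:R + e by rewrite ltrDl.
  split; first by rewrite (le_trans _ (ltW me)).
  by apply: coverable_hausdorff_measure_eq0 => delta eps; exact: coverable_W.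
apply: le_ereal_inf_tmp => _ [s [s0 Hs] <-]; rewrite lee_fin.
have [m0|m0] := posnP m; first by rewrite m0.
rewrite leNgt; apply/negP => /ltW sm.
have [xi [xi01 xi_irr xi_approx]] :=
  @exists_Liouville R (fun n => (n ^ m.+3).+1) (fun=> isT).
apply: (not_null_W xi01 xi_irr xi_approx m0) => e e0.
apply: (@coverable_exponent _ _ s); first by rewrite s0.
exact: hausdorff_measure_eq0_coverable.
Qed.
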